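(* Let $G$ be an $N$-free ordered group with identity $e$. The following are equivalent. (i) $G$ has no infinite antichain; (ii) $G$ has finite width; (iii) the canonical chain $\mathcal V(G)$ is finite and every type $\mathbf A$ quotient $H/H^-$ ($H\in\mathcal V(G)$) is finite. Equivalently, there is a finite chain of convex subgroups $$\{e\}=H_0<H_1<\cdots<H_r=G$$ such that every $H_i$ is normal in $G$, the nontrivial factors $H_i/H_{i-1}$ alternate between totally ordered groups and finite equality-ordered groups, and the order on $G$ is the leading-factor order. Moreover, $$\operatorname{width}(G)=\prod_{H_i/H_{i-1}\text{ of type }\mathbf A}|H_i/H_{i-1}|.$$
   Context: An ordered group is a group $G$ (identity $e$) equipped with a partial order $\le$ such that $x\le y$ implies $axb\le ayb$ for all $a,b,x,y\in G$. A poset is $N$-free if it has no four distinct elements $a,b,c,d$ whose only strict comparabilities among themselves are $a<b$, $c<b$, $c<d$. The width of a poset is the maximum size of an antichain; finite width means this maximum exists (is finite). A module of a poset $X$ is a subset $M$ such that for every $x\in X\setminus M$ and $m,m'\in M$: $x\le m\iff x\le m'$ and $m\le x\iff m'\le x$. A nonempty module $M$ is strong if every module is disjoint from $M$, contained in $M$, or contains $M$. $S(x,y)$ is the least strong module containing $x$ and $y$. The canonical chain is $\mathcal V(G):=\{S(e,g):g\ne e\}$, and $H^-:=\{e\}\cup\bigcup\{L\in\mathcal V(G):L\subsetneq H\}$ for $H\in\mathcal V(G)$. It is known that $\mathcal V(G)$ is a chain under inclusion of convex subgroups, that $H^-$ is a proper convex normal subgroup of $H$, and, for $N$-free $G$,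 that $H/H^-$ with the quotient order ($\alpha\le\beta$ iff $a\le b$ for some $a\in\alpha,b\in\beta$) is either totally ordered (type $\mathbf C$) or equality-ordered, i.e. its order is equality (type $\mathbf A$). For a finite chain $\{e\}=H_0<\dots<H_r=G$ as in the statement, a factor $H_i/H_{i-1}$ (with the quotient order) has type $\mathbf C$ if it is totally ordered and type $\mathbf A$ if it is equality-ordered. The order on $G$ is the leading-factor order if for every $g\ne e$, with $i$ least such that $g\in H_i$: $g>e$ iff $H_i/H_{i-1}$ is of type $\mathbf C$ and $gH_{i-1}>H_{i-1}$ in $H_i/H_{i-1}$; and $x<y$ iff $x^{-1}y>e$. An empty product is $1$. *)

(* Defs.v *)
From HB Require Import structures.
From mathcomp Require Import all_boot all_order.
From mathcomp Require Import finmap.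
From mathcomp Require Import boolp classical_sets functions cardinality.

Set Implicit Arguments.
Unset Strict Implicit.
Unset Printing Implicit Defensive.

Import Order.TTheory.

Local Open Scope group_scope.
Local Open Scope order_scope.
Local Open Scope card_scope.
Local Open Scope classical_set_scope.

HB.mixin Record Group_POrder_isOrderedGroup (d : Order.disp_t) G
    of Group G & Order.POrder d G := {
  le_mulg2 : forall a b x y : G, x <= y -> a * x * b <= a * y * b
}.

#[short(type="orderedGroupType")]
HB.structure Definition OrderedGroup (d : Order.disp_t) :=
  { G of Group G & Order.POrder d G & Group_POrder_isOrderedGroup d G }.

Section Poset.
Context {d : Order.disp_t} {X : porderType d}.
Implicit Types (x y m : X) (A M : set X).

Definition Nfree : Prop :=
  ~ exists a b c e : X,
      [/\ uniq [:: a; b; c; e],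
          [/\ a < b, c < b & c < e]
        & [/\ a >< c, a >< e & b >< e]].

Definition antichain A : Prop :=
  forall x y, A x -> A y -> x != y -> x >< y.

Definition has_width (n : nat) : Prop :=
  (exists2 A, antichain A & A #= `I_n) /\
  (forall A, antichain A -> A #<= `I_n).

Definition convex_set A : Prop :=
  forall x y z, A x -> A z -> x <= y -> y <= z -> A y.

Definition is_module M : Prop :=
  forall x m m', ~ M x -> M m -> M m' ->
    (x <= m <-> x <= m') /\ (m <= x <-> m' <= x).

Definition strong_module M : Prop :=
  [/\ M !=set0, is_module M
    & forall N, is_module N -> [\/ N `&` M = set0, N `<=` M | M `<=` N]].

(* An intersection of sets; [strong_span_strong] shows that it is itself a
   strong module, hence the least one containing x and y. *)
Definition strong_span x y : set X := smallest strong_module [set x; y].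

Lemma strong_span_strong x y : strong_module (strong_span x y).
Proof.
split.
- by exists x => M [_]; apply; left.
- move=> z m m' Sz Sm Sm'.
  have [M [[M_strong xyM] Mz]] :
      exists M, (strong_module M /\ [set x; y] `<=` M) /\ ~ M z.
    by apply: contra_notP Sz => /forallNP nM M /= MP; apply: contrapT => Mz;
       apply: (nM M).
  have [_ M_mod _] := M_strong.
  by apply: M_mod => //; [apply: Sm | apply: Sm'].
- move=> N N_mod.
  have [[M [MP dNM]]|nodisj] := pselect (exists M,
      (strong_module M /\ [set x; y] `<=` M) /\ N `&` M = set0).
    apply: Or31; apply/seteqP; split=> // z [Nz Sz].
    by rewrite -dNM; split=> //; apply: Sz.
  have [[M [MP MN]]|nosub] := pselect (exists M,
      (strong_module M /\ [set x; y] `<=` M) /\ M `<=` N).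
    by apply: Or33 => z Sz; apply: MN; apply: Sz.
  apply: Or32 => z Nz M /= MP; have [[_ _ M_strong] _] := MP.
  have [dNM|NM|MN] := M_strong N N_mod; last by case: nosub; exists M.
    by case: nodisj; exists M.
  exact: NM.
Qed.

End Poset.

Arguments Nfree {d} X.
Arguments has_width {d} X n.

Section OrderedGroup.
Context {d : Order.disp_t} {G : orderedGroupType d}.
Implicit Types (g x y : G) (H K L : set G).

Definition is_subgroup H : Prop := group_closed [in H].

Definition normal_in_group H : Prop := forall h g, H h -> H (h ^ g).

Definition canonical_chain : set (set G) :=
  [set strong_span 1 g | g in [set g | g != 1]].

Definition canonical_pred H : set G :=
  [set 1] `|` \bigcup_(L in [set L | canonical_chain L /\ L `<` H]) L.

Definition lcoset K x : set G := [set x * k | k in K].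

Definition factor H K : set (set G) := [set lcoset K x | x in H].

Definition factor_le (alpha beta : set G) : Prop :=
  exists a b, [/\ alpha a, beta b & a <= b].

Definition factor_lt (alpha beta : set G) : Prop :=
  factor_le alpha beta /\ alpha <> beta.

Definition typeC H K : Prop :=
  forall alpha beta, factor H K alpha -> factor H K beta ->
    factor_le alpha beta \/ factor_le beta alpha.

Definition typeA H K : Prop :=
  forall alpha beta, factor H K alpha -> factor H K beta ->
    (factor_le alpha beta <-> alpha = beta).

(* Only H 0, ..., H r matter. *)
Definition leading_factor_order (r : nat) (H : nat -> set G) : Prop :=
  (forall g i, g != 1 -> (i <= r)%N -> H i g ->
     (forall j, (j < i)%N -> ~ H j g) ->
     (1 < g <->
        typeC (H i) (H i.-1) /\ factor_lt (H i.-1) (lcoset (H i.-1) g))) /\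
  (forall x y, x < y <-> 1 < x^-1 * y).

(* The inclusions are strict, so every factor is nontrivial, hence not of both
   types; the last conjunct therefore expresses alternation. *)
Definition leading_factor_chain (r : nat) (H : nat -> set G) : Prop :=
  [/\ [/\ H 0%N = [set 1], H r = setT
        & forall i, (i < r)%N -> H i `<` H i.+1],
      forall i, (i <= r)%N ->
        [/\ is_subgroup (H i), convex_set (H i) & normal_in_group (H i)],
      forall i, (i < r)%N ->
        typeC (H i.+1) (H i) \/
        (typeA (H i.+1) (H i) /\ finite_set (factor (H i.+1) (H i))),
      forall i, (i.+1 < r)%N ->
        (typeC (H i.+1) (H i) <-> typeA (H i.+2) (H i.+1))
    & leading_factor_order r H].

Definition typeA_product (r : nat) (H : nat -> set G) : nat :=
  (\prod_(i < r | `[< typeA (H i.+1) (H i) >])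
     #|` fset_set (factor (H i.+1) (H i))|%fset)%N.

End OrderedGroup.

Arguments canonical_chain {d} G.

(* Main.v *)
(* In a P4-free graph, if e and g are not adjacent, then the set of vertices
   adjacent to every common neighbour of e and g is a strong module, in which e
   and g lie in different components. Applied to the comparability and to the
   incomparability graph of an N-free order, this shows that S(e,g) and S(e,x)
   differ as soon as exactly one of g, x is comparable to e; for e = 1 this
   determines the type of H/H^-. S(1,g) is a subgroup because left translations and
   inversion preserve strong modules and strong modules sharing a point are
   nested. Two members of the chain of one type always have a member of the
   other type between them, since otherwise the smaller one would be overlapped
   by a module. Generators of distinct type A members are incomparable, so
   without infinite antichains there are finitely many type A members, hence
   finitely many members at all. Conversely, along a leading-factor chain an
   antichain meets a single coset in a type C step and is spread over all
   cosets in a type A step, which gives the width by induction. *)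

Require Import Defs.
From mathcomp Require Import all_boot all_order.
From mathcomp Require Import finmap.
From mathcomp Require Import boolp classical_sets functions cardinality.

Set Implicit Arguments.
Unset Strict Implicit.
Unset Printing Implicit Defensive.

Import Order.TTheory.

Local Open Scope classical_set_scope.

(** * Graph modules generated by common neighbours in a P4-free graph *)

Section CommonNeighbours.
Variables (T : Type) (adj : T -> T -> Prop).
Hypothesis adjC : forall x y, adj x y -> adj y x.
Hypothesis adj_P4free : forall a b c e,
  adj a b -> adj b c -> adj c e -> [\/ adj a c, adj a e | adj b e].

(** One implication is enough, since [m] and [m'] may be exchanged. *)
Definition graph_module (M : set T) : Prop :=
  forall z m m', ~ M z -> M m -> M m' -> adj z m -> adj z m'.

Definition common_span (e g : T) : set T :=
  [set x | forall y, adj y e -> adj y g -> adj y x].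

Variables e g : T.
Hypothesis adj_irr : forall x, ~ adj x x.
Hypothesis eg_nonadj : ~ adj e g.

Lemma common_span_nonadj x : common_span e g x -> adj x e -> ~ adj x g.
Proof. by move=> Sx xe xg; apply: (@adj_irr x); apply: Sx. Qed.

(* [e] and [g] lie in different components of their span. *)
Lemma common_span_far m m' : common_span e g m -> common_span e g m' ->
  adj m m' -> exists w, [/\ common_span e g w, ~ adj w m & ~ adj w m'].
Proof.
move=> Sm Sm' mm'.
have Se : common_span e g e by [].
have Sg : common_span e g g by [].
(* The path [e], [p], [q], [g] is impossible: a chord would join [e] to [g], or make [p] or [q] a
   common neighbour, hence adjacent to itself. *)
have cross p q : common_span e g p -> common_span e g q ->
    adj p q -> adj p e -> ~ adj q g.
  move=> Sp Sq pq pe qg; have /adjC ep := pe.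
  by case: (adj_P4free ep pq qg) => [/adjC qe|//|pg];
    [apply: (common_span_nonadj Sq) | apply: (common_span_nonadj Sp)].
have [me|me] := pselect (adj m e).
  exists g; split=> // /adjC; first exact: common_span_nonadj.
  exact: cross mm' me.
have [m'e|m'e] := pselect (adj m' e); last by exists e; split=> // /adjC.
exists g; split=> // /adjC; last exact: common_span_nonadj.
exact: cross (adjC mm') m'e.
Qed.

Lemma common_spanN z : ~ common_span e g z ->
  exists y, [/\ adj y e, adj y g & ~ adj y z].
Proof.
apply: contra_notP => noy y ye yg; apply: contrapT => yz.
by apply: noy; exists y.
Qed.

(** An outside point [z] misses some common neighbour [y]. The path [z], [p], [y], [q] then carries
    adjacency to [z] from [p] to any [q] not adjacent to [p]; adjacent [m], [m'] are linked through
    a point nonadjacent to both. *)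
Lemma common_span_graph_module : graph_module (common_span e g).
Proof.
move=> z m m' /common_spanN[y [ye yg yz]] Sm Sm' zm.
have key p q : common_span e g p -> common_span e g q -> ~ adj p q ->
    adj z p -> adj z q.
  move=> Sp Sq pq zp.
  by case: (adj_P4free zp (adjC (Sp _ ye yg)) (Sq _ ye yg)) => [/adjC|//|//].
have [mm'|mm'] := pselect (adj m m'); last exact: key mm' zm.
have [w [Sw wm wm']] := common_span_far Sm Sm' mm'.
by apply: (key w) => //; apply: (key m) => // /adjC.
Qed.

Lemma common_span_overlap N : graph_module N ->
  [\/ N `&` common_span e g = set0, N `<=` common_span e g
    | common_span e g `<=` N].
Proof.
move=> Nmod.
have [[n [Nn Sn]]|NS0] := pselect (N `&` common_span e g !=set0); last first.
  by apply: Or31; apply: contrapT => /eqP/set0P.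
have [NS|/existsNP[z /not_implyP[Nz Sz]]] :=
  pselect (N `<=` common_span e g); first exact: Or32.
apply: Or33 => w Sw; apply: contrapT => Nw.
(* An edge from such a [z'] into the span reaches the whole span, so every point of the span outside
   [N] is adjacent to all of [N]. A point [u] far from both [w] and [n] contradicts this, whether or
   not it lies in [N]. *)
have joined z' s : N z' -> ~ common_span e g z' -> common_span e g s ->
    ~ adj z' s.
  move=> Nz' Sz' Ss z's.
  have z'S u : common_span e g u -> adj z' u.
    by move=> Su; apply: common_span_graph_module z's.
  have SNadj u v : common_span e g u -> ~ N u -> N v -> adj u v.
    by move=> Su Nu Nv; apply: (Nmod _ z') => //; apply/adjC/z'S.
  have [u [Su uw un]] := common_span_far Sw Sn (SNadj _ _ Sw Nw Nn).
  have [Nu|Nu] := pselect (N u); first by apply/uw/adjC/SNadj.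
  exact/un/SNadj.
have [y [ye yg yz]] := common_spanN Sz.
have Sy : ~ common_span e g y by move=> /common_span_nonadj; exact.
have [Ny|Ny] := pselect (N y); first exact: (joined y e).
by apply: yz; apply: (Nmod _ n) => //; apply: Sn.
Qed.

End CommonNeighbours.

(** * Strong modules of N-free posets and their behaviour under symmetries *)

Section PosetSpans.
Local Open Scope order_scope.
Context {d : Order.disp_t} {X : porderType d}.
Implicit Types (x y z m e g : X) (M N : set X).

Definition strictly_comparable x y : Prop := x < y \/ y < x.

Lemma strictly_comparableP x y :
  strictly_comparable x y <-> x != y /\ x >=< y.
Proof.
split=> [[xy|yx]|[nxy /orP[xy|yx]]].
- by rewrite lt_eqF // lt_comparable.
- by rewrite gt_eqF // gt_comparable.
- by left; rewrite lt_neqAle nxy.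
- by right; rewrite lt_neqAle eq_sym nxy.
Qed.

Lemma strictly_comparableC x y :
  strictly_comparable x y -> strictly_comparable y x.
Proof. by case; [right|left]. Qed.

Lemma strictly_comparablexx x : ~ strictly_comparable x x.
Proof. by case; rewrite ltxx. Qed.

(** By transitivity the edges of a chordless path alternate in direction, and such a zigzag is an N
    when read from the appropriate end. *)
Lemma strictly_comparable_P4free (XN : Nfree X) a b c e :
  strictly_comparable a b -> strictly_comparable b c ->
  strictly_comparable c e ->
  [\/ strictly_comparable a c, strictly_comparable a e
    | strictly_comparable b e].
Proof.
have N4 p q r s : p < q -> r < q -> r < s ->
    ~ strictly_comparable p r -> ~ strictly_comparable p s ->
    ~ strictly_comparable q s -> False.
  move=> pq rq rs pr ps qs; apply: XN; exists p, q, r, s.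
  have npr : p != r by apply/eqP => E; apply: ps; left; rewrite E.
  have nps : p != s by apply/eqP => E; apply: qs; right; rewrite -E.
  have nqs : q != s by apply/eqP => E; apply: ps; left; rewrite -E.
  split; first by rewrite /= !inE !negb_or npr nps nqs (lt_eqF pq) (gt_eqF rq)
    (lt_eqF rs).
    by [].
  by split; apply/negP => cmp; [apply: pr|apply: ps|apply: qs];
    apply/strictly_comparableP.
move=> ab bc ce.
have [ac|nac] := pselect (strictly_comparable a c); first exact: Or31.
have [ae|nae] := pselect (strictly_comparable a e); first exact: Or32.
have [be|nbe] := pselect (strictly_comparable b e); first exact: Or33.
exfalso; case: ab => [ab|ba].
  case: bc => [bc|cb]; first by apply: nac; left; apply: lt_trans bc.
  case: ce => [ce|ec]; last by apply: nbe; right; apply: lt_trans cb.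
  exact: (N4 a b c e).
case: bc => [bc|cb]; last by apply: nac; right; apply: lt_trans ba.
case: ce => [ce|ec]; first by apply: nbe; left; apply: lt_trans ce.
by apply: (N4 e c b a) => // /strictly_comparableC.
Qed.

(** P4 is self-complementary: a chordless path [a], [b], [c], [e] of incomparabilities gives the
    path [c], [a], [e], [b] of comparabilities. *)
Lemma incomparable_P4free (XN : Nfree X) a b c e :
  a >< b -> b >< c -> c >< e -> [\/ a >< c, a >< e | b >< e].
Proof.
move=> ab bc ce.
have [ac|ac] := boolP (a >=< c); last exact: Or31.
have [ae|ae] := boolP (a >=< e); last exact: Or32.
have [be|be] := boolP (b >=< e); last exact: Or33.
exfalso.
have nac : c != a by apply/eqP => E; move: ce; rewrite E ae.
have nae : a != e by apply/eqP => E; move: ab; rewrite E comparable_sym be.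
have nbe : e != b by apply/eqP => E; move: ab; rewrite -E ae.
have ca : strictly_comparable c a.
  by apply/strictly_comparableP; rewrite comparable_sym.
have {}ae : strictly_comparable a e by apply/strictly_comparableP.
have eb : strictly_comparable e b.
  by apply/strictly_comparableP; rewrite comparable_sym.
have [] := strictly_comparable_P4free XN ca ae eb => /strictly_comparableP[_].
- by rewrite (negPf ce).
- by rewrite comparable_sym (negPf bc).
- by rewrite (negPf ab).
Qed.

Lemma half_module M :
  (forall z m m', ~ M z -> M m -> M m' ->
    (z <= m -> z <= m') /\ (m <= z -> m' <= z)) -> is_module M.
Proof.
move=> half z m m' Mz Mm Mm'.
have [zm mz] := half z m m' Mz Mm Mm'; have [zm' mz'] := half z m' m Mz Mm' Mm.
by split; split.
Qed.

Lemma module_strictly_comparable M : is_module M ->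
  graph_module strictly_comparable M.
Proof.
move=> Mmod z m m' Mz Mm Mm'; have [zm mz] := Mmod z m m' Mz Mm Mm'.
have nzm' : z != m' by apply/eqP => E; apply: Mz; rewrite E.
move=> /strictly_comparableP[_ /orP cmp]; apply/strictly_comparableP.
by split=> //; apply/orP; case: cmp => [/zm|/mz]; [left|right].
Qed.

Lemma module_incomparable M : is_module M ->
  graph_module (fun x y => x >< y) M.
Proof.
move=> Mmod z m m' Mz Mm Mm' zm; have [zm' mz'] := Mmod z m m' Mz Mm Mm'.
by apply: contra zm => /orP[/zm'|/mz'] le; rewrite /Order.comparable le ?orbT.
Qed.

Lemma common_span_comparable_strong (XN : Nfree X) e g : e >< g ->
  strong_module (common_span strictly_comparable e g).
Proof.
move=> eg; set S := common_span _ _ _.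
have adjC := strictly_comparableC.
have P4f := strictly_comparable_P4free XN.
have nadj : ~ strictly_comparable e g.
  by move=> /strictly_comparableP[_]; rewrite (negPf eg).
have Smod := common_span_graph_module adjC P4f strictly_comparablexx nadj.
split; first by exists e.
- apply: half_module => z m m' Sz Sm Sm'.
  have nz p : S p -> z != p by move=> Sp; apply/eqP => E; rewrite E in Sz.
  have cz p q : S p -> S q -> strictly_comparable z p ->
    strictly_comparable z q := Smod z p q Sz.
  (* A graph module ignores the direction of comparabilities. It is recovered here: with [z] between
     [p] and [q], a point [w] of the span incomparable to both would be comparable to [z], hence by
     transitivity to [p] or to [q]. *)
  have far p q : S p -> S q -> p < z -> z < q -> False.
    move=> Sp Sq pz zq.
    have pq : strictly_comparable p q by left; apply: lt_trans zq.
    have [w [Sw wp wq]] :=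
      common_span_far adjC P4f strictly_comparablexx nadj Sp Sq pq.
    have [|zw|wz] := cz p w Sp Sw; first by right.
      by apply: wp; right; apply: lt_trans zw.
    by apply: wq; left; apply: lt_trans zq.
  split=> [zm|mz].
    have {}zm : z < m by rewrite lt_neqAle nz.
    have [|/ltW//|m'z] := cz m m' Sm Sm'; first by left.
    by case: (far m' m).
  have {}mz : m < z by rewrite lt_neqAle eq_sym nz.
  have [|zm'|/ltW//] := cz m m' Sm Sm'; first by right.
  by case: (far m m').
- by move=> N /module_strictly_comparable Nmod;
     exact: (common_span_overlap adjC P4f strictly_comparablexx nadj Nmod).
Qed.

Lemma common_span_incomparable_strong (XN : Nfree X) e g : e >=< g ->
  strong_module (common_span (fun x y => x >< y) e g).
Proof.
move=> eg; set adj := fun x y => _; set S := common_span _ _ _.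
have adjC x y : adj x y -> adj y x by rewrite /adj comparable_sym.
have P4f := @incomparable_P4free XN.
have adj_irr x : ~ adj x x by rewrite /adj comparablexx.
have nadj : ~ adj e g by rewrite /adj eg.
have Smod := common_span_graph_module adjC P4f adj_irr nadj.
split; first by exists e.
- apply: half_module => z m m' Sz Sm Sm'.
  (* This [y] is comparable to [z] but incomparable to [m] and [m'], so [z] cannot lie between [m]
     and [m']. *)
  have [y [ye yg /negP/negPn yz]] := common_spanN Sz.
  have /negP ym := Sm y ye yg; have /negP ym' := Sm' y ye yg.
  have zm' : z >=< m -> z >=< m'.
    by apply: contraTT => zm'; apply: (Smod z m' m).
  split=> [zm|mz].
    have /orP[//|m'z] : z >=< m' by apply: zm'; rewrite /Order.comparable zm.
    case/orP: yz => [yz|zy]; first by case: ym; rewrite le_comparable ?(le_trans yz).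
    by case: ym'; rewrite ge_comparable // (le_trans m'z).
  have /orP[zm'1|//] : z >=< m'.
    by apply: zm'; rewrite /Order.comparable mz orbT.
  case/orP: yz => [yz|zy]; last by case: ym; rewrite ge_comparable ?(le_trans mz).
  by case: ym'; rewrite le_comparable // (le_trans yz).
- by move=> N /module_incomparable Nmod;
     exact: (common_span_overlap adjC P4f adj_irr nadj Nmod).
Qed.

Lemma strong_span_min x y M : strong_module M -> M x -> M y ->
  strong_span x y `<=` M.
Proof. by move=> Ms Mx My z; apply; split=> // _ [->|->]. Qed.

Lemma strong_spanl x y : strong_span x y x.
Proof. by move=> M [_]; apply; left. Qed.

Lemma strong_spanr x y : strong_span x y y.
Proof. by move=> M [_]; apply; right. Qed.

Lemma strong_spanC x y : strong_span x y = strong_span y x.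
Proof.
by apply/seteqP; split; apply: strong_span_min;
  do ?[exact: strong_span_strong | exact: strong_spanl | exact: strong_spanr].
Qed.

Lemma strong_nested M N x : strong_module M -> strong_module N ->
  M x -> N x -> M `<=` N \/ N `<=` M.
Proof.
move=> [_ Mmod _] [_ _ Nstrong] Mx Nx.
case: (Nstrong M Mmod) => [E| |]; [|by left|by right].
by have : set0 x by rewrite -E.
Qed.

(* The span of an incomparable pair is disconnected in the comparability
   graph, that of a comparable pair in the incomparability graph. *)
Lemma strong_span_kind (XN : Nfree X) e g x : e >< g -> e >=< x -> e != x ->
  strong_span e g <> strong_span e x.
Proof.
move=> eg ex nex E.
have : strong_span e g x by rewrite E; apply: strong_spanr.
have : strong_span e x g by rewrite -E; apply: strong_spanr.
move=> /(strong_span_min (common_span_incomparable_strong XN ex)) Ig.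
move=> /(strong_span_min (common_span_comparable_strong XN eg)) Cx.
(* If [g >< x], then [g] is incomparable to both [e] and [x], and [Ig] makes it incomparable to
   itself. Once [g] and [x] are comparable, [Cx] makes [x] strictly comparable to itself. *)
have gx : g >=< x.
  apply: contraT => gx; have : g >< g; last by rewrite comparablexx.
  apply: Ig => //; by rewrite comparable_sym.
apply: (@strictly_comparablexx x); apply: Cx => //; apply/strictly_comparableP.
  by rewrite eq_sym comparable_sym.
split; first by apply: contraTneq ex => ->.
by rewrite comparable_sym.
Qed.

Lemma module_convex M : is_module M -> convex_set M.
Proof.
move=> Mmod x y z Mx Mz xy yz; apply: contrapT => My.
have [[_ /(_ yz) yx] _] := Mmod y x z My Mx Mz.
by apply: My; rewrite (le_anti (x := y) (y := x)) // yx.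
Qed.

Lemma module_comparable M z m m' : is_module M -> ~ M z -> M m -> M m' ->
  z >=< m -> z >=< m'.
Proof.
move=> Mmod Mz Mm Mm' /orP cmp; have [zm mz] := Mmod z m m' Mz Mm Mm'.
by apply/orP; case: cmp => [/zm|/mz]; [left|right].
Qed.

Definition order_symmetry (f : X -> X) : Prop :=
  (forall x y, (f x <= f y) = (x <= y)) \/ (forall x y, (f x <= f y) = (y <= x)).

Lemma module_preimage f M : order_symmetry f -> is_module M ->
  is_module (f @^-1` M).
Proof.
move=> fsym Mmod z m m' /= Mz Mm Mm'.
by have := Mmod _ _ _ Mz Mm Mm'; case: fsym => fE; rewrite !fE => -[].
Qed.

Lemma strong_preimage f f' M : cancel f f' -> cancel f' f ->
  order_symmetry f -> order_symmetry f' -> strong_module M ->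
  strong_module (f @^-1` M).
Proof.
move=> fK f'K fsym f'sym [[m Mm] Mmod Mstrong]; split.
- by exists (f' m); rewrite /= f'K.
- exact: module_preimage.
move=> N /(module_preimage f'sym)/Mstrong[NM0|NM|MN].
- apply: Or31; apply/seteqP; split=> // z [Nz Mz].
  have : set0 (f z) by rewrite -NM0; split=> //=; rewrite fK.
  by [].
- by apply: Or32 => z Nz; have := NM (f z); rewrite /= fK; apply.
- by apply: Or33 => z /= /MN /=; rewrite fK.
Qed.

Lemma strong_span_morph f f' x y z : cancel f f' -> cancel f' f ->
  order_symmetry f -> strong_span (f x) (f y) (f z) <-> strong_span x y z.
Proof.
move=> fK f'K fsym.
have f'sym : order_symmetry f'.
  by case: fsym => fE; [left|right] => u v; rewrite -fE !f'K.
split.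
  have f'S : strong_module (f' @^-1` strong_span x y).
    exact: (strong_preimage f'K fK) (strong_span_strong _ _).
  move=> /(strong_span_min f'S) /=; rewrite !fK; apply.
    exact: strong_spanl.
  exact: strong_spanr.
have fS : strong_module (f @^-1` strong_span (f x) (f y)).
  exact: (strong_preimage fK f'K) (strong_span_strong _ _).
move=> /(strong_span_min fS); apply; [exact: strong_spanl|exact: strong_spanr].
Qed.

End PosetSpans.

(** * Translations and inversion in an ordered group; the spans of [1] are subgroups *)

Section OrderedGroups.
Local Open Scope group_scope.
Local Open Scope order_scope.
Local Open Scope card_scope.
Local Open Scope classical_set_scope.
Context {d : Order.disp_t} {G : orderedGroupType d}.
Implicit Types (a b g h x y z : G) (H K L : set G) (F : set (set G)).

Lemma le_mul2l a x y : (a * x <= a * y) = (x <= y).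
Proof.
apply/idP/idP => [/(le_mulg2 a^-1 1)|/(le_mulg2 a 1)]; rewrite !mulg1 //.
by rewrite !mulKg.
Qed.

Lemma lt_mul2l a x y : (a * x < a * y) = (x < y).
Proof. by rewrite !lt_leAnge !le_mul2l. Qed.

Lemma comparable_mul2l a x y : (a * x >=< a * y) = (x >=< y).
Proof. by rewrite /Order.comparable !le_mul2l. Qed.

Lemma comparable_div x y : (x^-1 * y >=< 1) = (x >=< y).
Proof. by rewrite -[LHS](comparable_mul2l x) mulVKg mulg1 comparable_sym. Qed.

Lemma lt_div x y : (1 < x^-1 * y) = (x < y).
Proof. by rewrite -[LHS](lt_mul2l x) mulVKg mulg1. Qed.

Lemma le_conj a x y : (x ^ a <= y ^ a) = (x <= y).
Proof.
have imp b u v : u <= v -> u ^ b <= v ^ b.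
  by move=> /(le_mulg2 b^-1 b); rewrite !conjgE !mulgA.
by apply/idP/idP => [/(imp a^-1)|/imp //]; rewrite !conjgK.
Qed.

Lemma le_inv x y : (x^-1 <= y^-1) = (y <= x).
Proof.
have imp u v : u <= v -> v^-1 <= u^-1.
  by move=> /(le_mulg2 u^-1 v^-1); rewrite mulVg mul1g mulgK.
by apply/idP/idP => /imp //; rewrite !invgK.
Qed.

Lemma strong_span_mul2l a x y z :
  strong_span (a * x) (a * y) (a * z) <-> strong_span x y z.
Proof.
apply: (strong_span_morph (f := *%g a) (f' := *%g a^-1)).
- exact: mulKg.
- exact: mulVKg.
- by left=> u v; rewrite le_mul2l.
Qed.

Lemma strong_span_conj a x y z :
  strong_span (x ^ a) (y ^ a) (z ^ a) <-> strong_span x y z.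
Proof.
apply: (strong_span_morph (f := conjg^~ a) (f' := conjg^~ a^-1)).
- exact: conjgK.
- exact: conjgKV.
- by left=> u v; rewrite le_conj.
Qed.

Lemma strong_span_inv x y z :
  strong_span x^-1 y^-1 z^-1 <-> strong_span x y z.
Proof.
pose inv (u : G) := u^-1.
apply: (strong_span_morph (f := inv) (f' := inv)); try exact: invgK.
by right=> u v; rewrite le_inv.
Qed.

Lemma strong_span_nested g h :
  strong_span 1 g `<=` strong_span 1 h \/ strong_span 1 h `<=` strong_span 1 g.
Proof.
by apply: (@strong_nested _ _ _ _ 1);
  do ?[exact: strong_span_strong | exact: strong_spanl].
Qed.

(** Inversion exchanges the spans of [1] with [g] and with [g^-1]. These are nested, and either
    inclusion gives the closure. *)
Lemma strong_span1V g z : strong_span 1 g z -> strong_span 1 g z^-1.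
Proof.
have VE u : strong_span 1 g^-1 u <-> strong_span 1 g u^-1.
  by rewrite -(strong_span_inv 1 g u^-1) invg1 invgK.
case: (strong_span_nested g g^-1) => sub gz.
  by apply: (VE z).1; apply: sub.
by apply: sub; apply: (VE z^-1).2; rewrite invgK.
Qed.

(** Translation by [g^-1] takes the span of [1] and [g] to that of [g^-1] and [1], which is also its
    image under inversion. *)
Lemma strong_span1_mulg g z : strong_span 1 g (g * z) <-> strong_span 1 g z.
Proof.
rewrite -[X in X <-> _](strong_span_mul2l g^-1) mulKg mulVg mulg1 strong_spanC.
rewrite -[X in X <-> _]strong_span_inv invg1 invgK.
by split=> /strong_span1V; rewrite ?invgK.
Qed.

(** The spans of [1, h] and of [h, g] share [h], so they are nested and the larger one is the whole
    span of [1, g]. In the first case this span is the translate by [h] of the span of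
    [1, h^-1 * g]; in the second it is the span of [1, h]. Both reduce to [strong_span1_mulg]. *)
Lemma strong_span1_mul g h z : strong_span 1 g h ->
  strong_span 1 g (h * z) <-> strong_span 1 g z.
Proof.
move=> gh.
have sub1 : strong_span 1 h `<=` strong_span 1 g.
  by apply: strong_span_min => //; [exact: strong_span_strong|exact: strong_spanl].
have sub2 : strong_span h g `<=` strong_span 1 g.
  by apply: strong_span_min => //; [exact: strong_span_strong|exact: strong_spanr].
have [||le1|le2] := @strong_nested _ _ (strong_span 1 h) (strong_span h g) h
    (strong_span_strong _ _) (strong_span_strong _ _).
- exact: strong_spanr.
- exact: strong_spanl.
- have E : strong_span 1 g = strong_span h g.
    apply/seteqP; split=> //; apply: strong_span_min.
    + exact: strong_span_strong.
    + by apply: le1; apply: strong_spanl.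
    + exact: strong_spanr.
  have KE u : strong_span 1 (h^-1 * g) u <-> strong_span 1 g (h * u).
    by rewrite -(strong_span_mul2l h) mulVKg mulg1 E.
  rewrite -KE -strong_span1_mulg KE -mulgA mulVKg; exact: strong_span1_mulg.
- have -> : strong_span 1 g = strong_span 1 h; last exact: strong_span1_mulg.
  apply/seteqP; split=> //; apply: strong_span_min.
  + exact: strong_span_strong.
  + exact: strong_spanl.
  + by apply: le2; apply: strong_spanr.
Qed.

(** * Subgroups, cosets and the two types of quotient *)

Lemma is_subgroupP H :
  is_subgroup H <-> H 1 /\ forall x y, H x -> H y -> H (x * y^-1).
Proof.
split=> [[H1 HM]|[H1 HM]].
  split; first by move: H1; rewrite inE.
  by move=> x y Hx Hy; have := HM x y; rewrite !inE; apply.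
by split=> [|x y]; rewrite !inE //; apply: HM.
Qed.

Lemma subgroup1 H : is_subgroup H -> H 1.
Proof. by move=> /is_subgroupP[]. Qed.

Lemma subgroupV H x : is_subgroup H -> H x -> H x^-1.
Proof. by move=> /is_subgroupP[H1 HM] Hx; rewrite -(mul1g x^-1); apply: HM. Qed.

Lemma subgroupM H x y : is_subgroup H -> H x -> H y -> H (x * y).
Proof.
move=> HS Hx Hy; rewrite -(invgK y); have [_] := (is_subgroupP H).1 HS.
by apply=> //; apply: subgroupV.
Qed.

Lemma subgroupMl H x y : is_subgroup H -> H x -> H (x * y) <-> H y.
Proof.
move=> HS Hx; split; last exact: subgroupM.
by move=> /(subgroupM HS (subgroupV HS Hx)); rewrite mulKg.
Qed.

Lemma strong_span1_subgroup g : is_subgroup (strong_span 1 g).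
Proof.
apply/is_subgroupP; split=> [|x y gx gy]; first exact: strong_spanl.
by apply/strong_span1_mul => //; apply: strong_span1V.
Qed.

Lemma set1_subgroup : is_subgroup [set 1 : G].
Proof. by apply/is_subgroupP; split=> // x y -> ->; rewrite mulgV. Qed.

Lemma lcosetE K x y : is_subgroup K -> lcoset K x y <-> K (x^-1 * y).
Proof.
move=> KS; split=> [[k Kk <-]|Kxy]; first by rewrite mulKg.
by exists (x^-1 * y); rewrite ?mulVKg.
Qed.

Lemma lcoset_refl K x : is_subgroup K -> lcoset K x x.
Proof. by move=> KS; apply/lcosetE; rewrite // mulVg; apply: subgroup1. Qed.

Lemma lcoset_eq K x y : is_subgroup K -> lcoset K x = lcoset K y <-> K (x^-1 * y).
Proof.
move=> KS; split=> [E|Kxy].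
  by apply/lcosetE => //; rewrite E; apply: lcoset_refl.
have E z : K (x^-1 * z) <-> K (y^-1 * z).
  by rewrite -(subgroupMl (y^-1 * z) KS Kxy) -mulgA mulVKg.
by apply/seteqP; split=> z /(lcosetE _ _ KS)/E Kz; apply/(lcosetE _ _ KS).
Qed.

Lemma lcoset1 K : lcoset K 1 = K.
Proof.
by apply/seteqP; split=> [_ [k Kk <-]|k Kk]; [|exists k]; rewrite ?mul1g.
Qed.

Lemma typeA_comparable H K x y : is_subgroup H -> is_subgroup K ->
  typeA H K -> H x -> H y -> x >=< y -> K (x^-1 * y).
Proof.
move=> HS KS HA Hx Hy /orP cmp; apply/lcoset_eq => //.
have in_factor z : H z -> factor H K (lcoset K z) by exists z.
have le u v : H u -> H v -> u <= v -> lcoset K u = lcoset K v.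
  move=> Hu Hv uv; apply/(HA _ _ (in_factor _ Hu) (in_factor _ Hv)).
  by exists u, v; split=> //; apply: lcoset_refl.
by case: cmp => [/le|/le]; [apply | move=> ->].
Qed.

Lemma typeA_typeC_trivial H K : is_subgroup H -> is_subgroup K ->
  typeA H K -> typeC H K -> H `<=` K.
Proof.
move=> HS KS HA HC g Hg.
have f1 : factor H K (lcoset K 1) by exists 1 => //; apply: subgroup1.
have fg : factor H K (lcoset K g) by exists g.
rewrite -(mul1g g) -invg1; apply/lcoset_eq => //.
by case: (HC _ _ f1 fg) => [/(HA _ _ f1 fg)|/(HA _ _ fg f1)->].
Qed.

Lemma subgroup_module_comparable K z m : is_subgroup K -> is_module K ->
  ~ K z -> K m -> z >=< m -> z >=< 1.
Proof.
move=> KS Kmod Kz Km; apply: module_comparable Kmod Kz Km _.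
exact: subgroup1.
Qed.

(** * Members of the canonical chain and their predecessors *)

Lemma canonicalP H : canonical_chain G H <-> exists2 g, g != 1 & H = strong_span 1 g.
Proof. by split=> [[g g1 <-]|[g g1 ->]]; exists g. Qed.

Lemma canonical_strong H : canonical_chain G H -> strong_module H.
Proof. by move=> [g _ <-]; apply: strong_span_strong. Qed.

Lemma canonical_subgroup H : canonical_chain G H -> is_subgroup H.
Proof. by move=> [g _ <-]; apply: strong_span1_subgroup. Qed.

Lemma canonical1 H : canonical_chain G H -> H 1.
Proof. by move=> /canonical_subgroup/subgroup1. Qed.

Lemma canonical_nested H K : canonical_chain G H -> canonical_chain G K ->
  H `<=` K \/ K `<=` H.
Proof. by move=> [g _ <-] [h _ <-]; apply: strong_span_nested. Qed.

Lemma canonical_span_sub H x : canonical_chain G H -> H x ->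
  strong_span 1 x `<=` H.
Proof.
move=> VH Hx; apply: strong_span_min => //; first exact: canonical_strong.
exact: canonical1.
Qed.

Lemma canonical_predP H x :
  canonical_pred H x <-> x = 1 \/ strong_span 1 x `<` H.
Proof.
split=> [[->|[L [VL [LH nHL]] Lx]]|[->|xH]]; [by left| |by left|].
  right; have xL := canonical_span_sub VL Lx.
  by split=> [z /xL/LH //|Hx]; apply: nHL => z /Hx/xL.
have [->|x1] := eqVneq x 1; first by left.
right; exists (strong_span 1 x); last exact: strong_spanr.
by split=> //; exists x.
Qed.

Lemma canonical_pred_sub H : canonical_chain G H -> canonical_pred H `<=` H.
Proof.
move=> VH x /canonical_predP[->|[xH _]].
  exact: canonical1.
by apply: xH; apply: strong_spanr.
Qed.

Lemma canonical_predN H x : canonical_chain G H -> H x ->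
  ~ canonical_pred H x -> strong_span 1 x = H.
Proof.
move=> VH Hx nx; apply/seteqP; split; first exact: canonical_span_sub.
by apply: contrapT => nsub; apply/nx/canonical_predP; right; split=> //;
  apply: canonical_span_sub.
Qed.

Lemma span_not_pred g : g != 1 -> ~ canonical_pred (strong_span 1 g) g.
Proof. by move=> /eqP g1 /canonical_predP[//|[_]]; apply. Qed.

(** The union is directed, so properties involving two of its points, such as being a subgroup or a
    module, are inherited from the members. *)
Lemma canonical_pred_cover H x y : canonical_pred H x -> canonical_pred H y ->
  (x = 1 /\ y = 1) \/ exists L, [/\ canonical_chain G L, L `<` H, L x & L y].
Proof.
move=> [->|[L [VL LH] Lx]] [->|[M [VM MH] My]].
- by left.
- by right; exists M; split=> //; apply: canonical1.
- by right; exists L; split=> //; apply: canonical1.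
right; case: (canonical_nested VL VM) => sub; [exists M | exists L]; split=> //.
  exact: sub.
exact: sub.
Qed.

Lemma canonical_pred_subgroup H : is_subgroup (canonical_pred H).
Proof.
apply/is_subgroupP; split=> [|x y Hx Hy]; first by left.
have [[-> ->]|[L [VL LH Lx Ly]]] := canonical_pred_cover Hx Hy.
  by left; rewrite mulgV.
have LS := canonical_subgroup VL.
by right; exists L => //; apply: subgroupM => //; apply: subgroupV.
Qed.

Lemma canonical_pred_module H : is_module (canonical_pred H).
Proof.
move=> z m m' Hz Hm Hm'.
have [[-> ->]//|[L [VL LH Lm Lm']]] := canonical_pred_cover Hm Hm'.
have [_ Lmod _] := canonical_strong VL.
by apply: Lmod => // Lz; apply: Hz; right; exists L.
Qed.

(** This and [antichain_kind] are elementwise forms of types C and A, testing only comparability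
    with [1]; for N-free groups they are equivalent to the types of the quotient. *)
Definition order_kind H := forall x, H x -> x >< 1 -> canonical_pred H x.

Definition antichain_kind H := forall x, H x -> x >=< 1 -> canonical_pred H x.

(** Every element of [H] outside [canonical_pred H] generates [H], and by [strong_span_kind]
    generators of one span agree on comparability with [1]. *)
Lemma canonical_kind (GN : Nfree G) H : canonical_chain G H ->
  order_kind H \/ antichain_kind H.
Proof.
move=> VH; have [g g1 E] := (canonicalP H).1 VH.
have [cg|ig] := boolP (g >=< 1); [left|right] => x Hx xk; apply: contrapT => nx;
  have := canonical_predN VH Hx nx; rewrite E.
  by apply: strong_span_kind; rewrite // 1?eq_sym // comparable_sym.
move/esym; apply: strong_span_kind; rewrite // 1?comparable_sym //.
by rewrite eq_sym; apply/eqP => x1; apply: nx; left.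
Qed.

Lemma canonical_kind_excl H : canonical_chain G H ->
  order_kind H -> antichain_kind H -> False.
Proof.
move=> [g g1 <-] HC HA; apply: (@span_not_pred g) => //.
have [cg|ig] := boolP (g >=< 1); [apply: HA|apply: HC] => //;
  exact: strong_spanr.
Qed.

Lemma order_kind_typeC H : canonical_chain G H -> order_kind H ->
  typeC H (canonical_pred H).
Proof.
move=> VH HC _ _ [x Hx <-] [y Hy <-].
have HS := canonical_subgroup VH; have PS := canonical_pred_subgroup H.
have refl z := lcoset_refl z PS.
have [/orP[xy|yx]|ixy] := boolP (x >=< y).
- by left; exists x, y.
- by right; exists y, x.
have -> : lcoset (canonical_pred H) x = lcoset (canonical_pred H) y.
  apply/lcoset_eq => //; apply: HC; last by rewrite comparable_div.
  by apply: subgroupM => //; apply: subgroupV.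
by left; exists y, y.
Qed.

Lemma antichain_kind_typeA H : canonical_chain G H -> antichain_kind H ->
  typeA H (canonical_pred H).
Proof.
move=> VH HA _ _ [x Hx <-] [y Hy <-].
have HS := canonical_subgroup VH; have PS := canonical_pred_subgroup H.
split=> [|->]; last by exists y, y; split=> //; apply: lcoset_refl.
move=> [_ [_ [[k Pk <-] [l Pl <-] le]]].
have Hk := canonical_pred_sub VH Pk; have Hl := canonical_pred_sub VH Pl.
have : canonical_pred H ((x * k)^-1 * (y * l)).
  apply: HA; last by rewrite comparable_div le_comparable.
  by apply: subgroupM => //; [apply: subgroupV => //|]; apply: subgroupM.
have xk : lcoset (canonical_pred H) x = lcoset (canonical_pred H) (x * k).
  by apply/lcoset_eq => //; rewrite mulKg.
have yl : lcoset (canonical_pred H) y = lcoset (canonical_pred H) (y * l).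
  by apply/lcoset_eq => //; rewrite mulKg.
by move=> /lcoset_eq E; rewrite xk yl E.
Qed.

Lemma canonical_pred_proper H : canonical_chain G H ->
  ~ (H `<=` canonical_pred H).
Proof.
by move=> [g g1 <-] sub; apply: (span_not_pred g1); apply: sub;
  apply: strong_spanr.
Qed.

Lemma typeA_antichain_kind (GN : Nfree G) H : canonical_chain G H ->
  typeA H (canonical_pred H) <-> antichain_kind H.
Proof.
move=> VH; split; last exact: antichain_kind_typeA.
move=> HA; case: (canonical_kind GN VH) => // /(order_kind_typeC VH) HC.
case: (canonical_pred_proper VH); apply: typeA_typeC_trivial => //.
  exact: canonical_subgroup.
exact: canonical_pred_subgroup.
Qed.

Lemma typeC_order_kind (GN : Nfree G) H : canonical_chain G H ->
  typeC H (canonical_pred H) <-> order_kind H.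
Proof.
move=> VH; split; last exact: order_kind_typeC.
move=> HC; case: (canonical_kind GN VH) => // /(antichain_kind_typeA VH) HA.
case: (canonical_pred_proper VH); apply: typeA_typeC_trivial => //.
  exact: canonical_subgroup.
exact: canonical_pred_subgroup.
Qed.

Lemma canonical_pred_neq H : canonical_chain G H ->
  exists2 g, H g & ~ canonical_pred H g.
Proof.
by move=> [g g1 <-]; exists g; [exact: strong_spanr | exact: span_not_pred].
Qed.

(* Otherwise the final segment of [K] above [canonical_pred H] would be a
   module overlapping [H]. *)
Lemma order_kind_next H K : canonical_chain G H -> canonical_chain G K ->
  H `<` K -> order_kind H -> exists x, [/\ K x, x >< 1 & ~ canonical_pred H x].
Proof.
move=> VH VK [HK nKH] HC; apply: contrapT => none.
have PS := canonical_pred_subgroup H.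
have KC x : K x -> ~ canonical_pred H x -> x < 1 \/ 1 < x.
  move=> Kx nx; apply/strictly_comparableP; split.
    by apply/eqP => x1; apply: nx; left.
  by apply: contraT => ix; case: none; exists x.
have [_ _ Hstrong] := canonical_strong VH.
have [_ Kmod _] := canonical_strong VK.
have Hmod := canonical_pred_module (H := H).
have HS := canonical_subgroup VH; have KS := canonical_subgroup VK.
pose M := [set x | K x /\ (canonical_pred H x \/ 1 < x)].
have Mmod : is_module M.
  move=> z m m' Mz [Km Mm] [Km' Mm'].
  have [Kz|Kz] := pselect (K z); last exact: Kmod.
  have Pz : ~ canonical_pred H z by move=> Pz; apply: Mz; split; last by left.
  have z1 : z < 1.
    by case: (KC z Kz Pz) => // z1; case: Mz; split; last by right.
  (* Since [z < 1], it lies below [u] by transitivity, or because [canonical_pred H] is a module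
     containing [1]. *)
  have below u : canonical_pred H u \/ 1 < u -> z <= u /\ ~ u <= z.
    case=> [Pu|u1]; last first.
      have zu := lt_trans z1 u1.
      by split; [exact: ltW | rewrite lt_geF].
    have [[_ zu] [uz _]] := Hmod z u 1 Pz Pu (subgroup1 PS).
    by split; [exact/zu/ltW | move=> /uz; rewrite lt_geF].
  by have [] := below m Mm; have [] := below m' Mm'.
case: (Hstrong M Mmod) => [MH0|MH|HM].
- have : set0 (1 : G); last by [].
  rewrite -MH0; split; last exact: subgroup1.
  by split; [exact: subgroup1 | left; exact: subgroup1].
- apply: nKH => k Kk; have [Pk|Pk] := pselect (canonical_pred H k).
    exact: canonical_pred_sub.
  have [k1|k1] := KC k Kk Pk; last by apply: MH; split=> //; right.
  rewrite -(invgK k); apply: subgroupV => //; apply: MH; split.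
    exact: subgroupV.
  by right; rewrite -(mulg1 k^-1) lt_div.
(* A generator [g] of [H] and its inverse would both exceed [1]. *)
- have above g : H g -> ~ canonical_pred H g -> 1 < g.
    by move=> Hg Pg; case: (HM g Hg) => _ [].
  have [g Hg Pg] := canonical_pred_neq VH.
  have g1 := above g Hg Pg.
  have : 1 < g^-1.
    apply: above; first exact: subgroupV.
    by move=> /(subgroupV PS); rewrite invgK.
  by rewrite -(mulg1 g^-1) lt_div lt_gtF.
Qed.

(* Otherwise two cosets of [canonical_pred H] in [K], one of them outside [H],
   would form a module overlapping [H]. *)
Lemma antichain_kind_next H K : canonical_chain G H -> canonical_chain G K ->
  H `<` K -> antichain_kind H ->
  exists x, [/\ K x, x >=< 1 & ~ canonical_pred H x].
Proof.
move=> VH VK [HK nKH] HA; apply: contrapT => none.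
have PS := canonical_pred_subgroup H.
have KA x : K x -> x >=< 1 -> canonical_pred H x.
  by move=> Kx cx; apply: contrapT => nx; case: none; exists x.
have [_ _ Hstrong] := canonical_strong VH.
have [_ Kmod _] := canonical_strong VK.
have Hmod := canonical_pred_module (H := H).
have HS := canonical_subgroup VH; have KS := canonical_subgroup VK.
have PK x : canonical_pred H x -> K x.
  by move=> /(canonical_pred_sub VH)/HK.
have [k Kk Hk] : exists2 k, K k & ~ H k.
  apply: contrapT => no; apply: nKH => k Kk; apply: contrapT => Hk.
  by apply: no; exists k.
pose M := [set x | canonical_pred H x \/ canonical_pred H (k^-1 * x)].
have MK x : M x -> K x.
  by case=> /PK // /(subgroupM KS Kk); rewrite mulVKg.
have Mmod : is_module M.
  move=> z m m' Mz Mm Mm'.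
  have [Kz|Kz] := pselect (K z); last by apply: Kmod => //; apply: MK.
  have indep u v : K u -> ~ canonical_pred H u -> canonical_pred H v -> u >< v.
    move=> Ku Pu Pv; apply/negP => uv; apply/Pu/KA => //.
    exact: subgroup_module_comparable PS Hmod Pu Pv uv.
  (* A point of [K] outside both cosets is incomparable to each of their elements; the coset of [k]
     reduces to that of [1] by translation. *)
  have incomp u : M u -> z >< u.
    move=> Mu; case: (Mu) => [Pu|Pu].
      by apply: indep => // Pz; apply: Mz; left.
    rewrite -(comparable_mul2l k^-1); apply: indep => //.
      by apply: subgroupM => //; apply: subgroupV.
    by move=> Pz; apply: Mz; right.
  have := incomp m Mm; have := incomp m' Mm'.
  by rewrite /Order.comparable !negb_or => /andP[/negPf-> /negPf->]
    /andP[/negPf-> /negPf->].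
case: (Hstrong M Mmod) => [MH0|MH|HM].
- have : set0 (1 : G); last by [].
  by rewrite -MH0; split; [left|]; exact: subgroup1.
- by apply/Hk/MH; right; rewrite mulVg; apply: subgroup1.
(* An element [g] of [H] outside [canonical_pred H] would lie in the coset of [k], forcing [k] into
   [H]. *)
- have [g Hg Pg] := canonical_pred_neq VH.
  case: (HM g Hg) => // /(canonical_pred_sub VH) Hkg; apply: Hk.
  rewrite -(invgK k); apply: subgroupV => //.
  by rewrite -(mulgK g k^-1); apply: subgroupM => //; apply: subgroupV.
Qed.

(** Taken over the type A members, it separates the type C members; taken over the whole chain, it
    is the descent measure for normality. *)
Definition rank F H : nat := #|` fset_set [set L | F L /\ L `<` H]|.

Lemma finite_below F H : finite_set F -> finite_set [set L | F L /\ L `<` H].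
Proof. by apply: sub_finite_set => L []. Qed.

Lemma rank_le F H : finite_set F -> (rank F H <= #|` fset_set F|)%N.
Proof.
move=> Ffin; apply: fsubset_leq_card; rewrite -fset_set_sub //.
  by move=> L [].
exact: finite_below.
Qed.

Lemma rank_lt F H K L : finite_set F -> H `<=` K -> F L -> L `<` K ->
  ~ L `<` H -> (rank F H < rank F K)%N.
Proof.
move=> Ffin HK FL LK LH; apply: fproper_ltn_card.
have fb M := finite_below M Ffin.
rewrite fproperE; apply/andP; split; last apply/negP.
  rewrite -fset_set_sub // => M [FM [MH nHM]]; split=> //.
  by split=> [x /MH/HK //|KM]; apply: nHM => x /HK/KM.
rewrite -fset_set_sub // => /(_ L)[] //.
Qed.

(** * Finiteness from the absence of infinite antichains *)

Section NoInfiniteAntichain.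
Hypothesis GN : Nfree G.
Hypothesis no_infinite_antichain :
  ~ exists A : set G, antichain A /\ infinite_set A.

Lemma antichain_kind_finite :
  finite_set [set H | canonical_chain G H /\ antichain_kind H].
Proof.
set VA := (X in finite_set X).
have /choice[f fP] : forall H, exists g, canonical_chain G H ->
    g != 1 /\ strong_span 1 g = H.
  move=> H.
  have [[g g1 E]|nH] := pselect (canonical_chain G H); last by exists 1.
  by exists g.
have finj : {in VA &, injective f}.
  move=> H K; rewrite !inE => -[VH _] [VK _] fHK.
  by rewrite -(fP H VH).2 fHK (fP K VK).2.
have fanti : antichain (f @` VA).
  (* The generator [f K] lies outside the module [H]. If it were comparable to [f H], it would be
     comparable to [1], hence in [canonical_pred K], and could not generate [K]. *)
  have lt H K : VA H -> VA K -> H `<=` K -> f H != f K -> f H >< f K.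
    move=> [VH HA] [VK KA] HK ne.
    have HfH : H (f H) by rewrite -{1}(fP H VH).2; apply: strong_spanr.
    have KfK : K (f K) by rewrite -{1}(fP K VK).2; apply: strong_spanr.
    have HfK : ~ H (f K).
      move=> HfK; have := canonical_span_sub VH HfK; rewrite (fP K VK).2 => KH.
      by move/eqP: ne; apply; congr f; apply/seteqP.
    apply/negP; rewrite comparable_sym => cmp.
    have [_ Hmod _] := canonical_strong VH.
    have := KA _ KfK (module_comparable Hmod HfK HfH (canonical1 VH) cmp).
    by rewrite -{1}(fP K VK).2; apply: span_not_pred; apply: (fP K VK).1.
  move=> _ _ [H VAH <-] [K VAK <-] ne.
  case: (canonical_nested VAH.1 VAK.1) => sub; first exact: lt.
  by rewrite comparable_sym; apply: lt; rewrite // eq_sym.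
rewrite -(eq_finite_set (inj_card_eq finj)).
by apply: contrapT => inf; apply: no_infinite_antichain; exists (f @` VA).
Qed.

Lemma canonical_chain_finite : finite_set (canonical_chain G).
Proof.
pose VA := [set H | canonical_chain G H /\ antichain_kind H].
pose VC := [set H | canonical_chain G H /\ order_kind H].
have VAfin : finite_set VA := antichain_kind_finite.
have VCfin : finite_set VC.
  (* The element given by [order_kind_next] spans a type A member strictly below [K] but not
     strictly below [H]. *)
  have lt H K : VC H -> VC K -> H `<` K -> (rank VA H < rank VA K)%N.
    move=> [VH HC] [VK KC] HK.
    have [x [Kx x1 Px]] := order_kind_next VH VK HK HC.
    have nx1 : x != 1 by apply: contraNneq x1 => ->; rewrite comparablexx.
    have Vx : canonical_chain G (strong_span 1 x) by exists x.
    have Ax : antichain_kind (strong_span 1 x).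
      case: (canonical_kind GN Vx) => // Cx.
      by case: (span_not_pred nx1); apply: Cx => //; apply: strong_spanr.
    apply: (@rank_lt _ _ _ (strong_span 1 x)) => //; first by case: HK.
      split; first exact: canonical_span_sub.
      move=> Kx'; apply: (canonical_kind_excl VK KC).
      by have -> : K = strong_span 1 x by apply/seteqP; split=> //;
        apply: canonical_span_sub.
    by move=> xH; apply/Px/canonical_predP; right.
  have inj : {in VC &, injective (rank VA)}.
    move=> H K; rewrite !inE => VCH VCK E; apply: contrapT => ne.
    case: (canonical_nested VCH.1 VCK.1) => sub.
      have : H `<` K by rewrite properEneq; split=> //; apply/eqP.
      by move=> /(lt _ _ VCH VCK); rewrite E ltnn.
    have : K `<` H by rewrite properEneq; split=> //; apply/eqP/nesym.
    by move=> /(lt _ _ VCK VCH); rewrite E ltnn.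
  rewrite -(eq_finite_set (inj_card_eq inj)).
  (* Ranks range from [0] to the number of type A members inclusive, whence the successor. *)
  apply: (sub_finite_set (B := `I_(#|` fset_set VA|).+1)); last exact: finite_II.
  by move=> _ [H _ <-] /=; rewrite ltnS; apply: rank_le.
apply: (sub_finite_set (B := VA `|` VC)); last by rewrite finite_setU.
by move=> H VH; case: (canonical_kind GN VH); [right|left].
Qed.

(** Comparable elements share a coset, so a choice of one representative per coset is an
    antichain. *)
Lemma typeA_factor_finite H K : is_subgroup H -> is_subgroup K ->
  typeA H K -> finite_set (factor H K).
Proof.
move=> HS KS HA; apply: contrapT => inf; apply: no_infinite_antichain.
have /choice[t tP] : forall C, exists g, factor H K C ->
    H g /\ lcoset K g = C.
  move=> C.
  have [[g Hg E]|nH] := pselect (factor H K C); last by exists 1.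
  by exists g.
have tinj : {in factor H K &, injective t}.
  by move=> C D; rewrite !inE => /tP[_ CE] /tP[_ DE] E; rewrite -CE E.
exists (t @` factor H K); split; last first.
  by rewrite (eq_finite_set (inj_card_eq tinj)).
move=> _ _ [C fC <-] [D fD <-] ne; apply/negP => cmp.
have [HC CE] := tP C fC; have [HD DE] := tP D fD.
move/eqP: ne; apply; congr t; rewrite -CE -DE; apply/lcoset_eq => //.
exact: typeA_comparable HA HC HD cmp.
Qed.

End NoInfiniteAntichain.

(** Conjugation permutes the members, so [H] and its conjugate are nested. A conjugate strictly
    inside [H] would, by iteration, give an infinite descent in a finite chain. *)
Lemma canonical_normal H : finite_set (canonical_chain G) ->
  canonical_chain G H -> normal_in_group H.
Proof.
move=> Vfin VH h a Hh.
pose conj K := [set x | K (x ^ a)].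
have Vconj K : canonical_chain G K -> canonical_chain G (conj K).
  move=> [g g1 <-]; exists (g ^ a^-1); first by rewrite /= conjg_eq1.
  have E x : strong_span 1 g (x ^ a) <-> strong_span 1 (g ^ a^-1) x.
    by rewrite -(strong_span_conj a 1 _ x) conj1g conjgKV.
  by apply/seteqP; split=> x /E.
have nproper n K : canonical_chain G K -> rank (canonical_chain G) K = n ->
    ~ conj K `<` K.
  elim/ltn_ind: n K => n IH K VK Kn conjK.
  have VcK := Vconj _ VK.
  apply: (IH (rank (canonical_chain G) (conj K)) _ (conj K)) => //.
    rewrite -Kn; apply: (@rank_lt _ _ _ (conj K)) => //; first by case: conjK.
    by case.
  case: conjK => sub nsub; split=> [x /sub //|sub'].
  by apply: nsub => x Kx; have := sub' (x ^ a^-1); rewrite /conj /= conjgKV; apply.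
have [sub|sub] := canonical_nested VH (Vconj _ VH); first exact: sub.
apply: contrapT => nHha; apply: (nproper _ H VH erefl).
by split=> // /(_ h Hh).
Qed.

(** * Construction of a leading-factor chain from a finite canonical chain *)

Lemma finite_nested_sequence F : finite_set F ->
  (forall H K, F H -> F K -> H `<=` K \/ K `<=` H) ->
  exists s : seq (set G), (forall H, F H <-> H \in s) /\
    forall i j, (i < j)%N -> (j < size s)%N -> nth setT s i `<` nth setT s j.
Proof.
move=> /finite_seqP[s0 Fs] nested.
pose le (H K : set G) := `[< H `<=` K >].
have memF H : F H <-> H \in undup s0 by rewrite mem_undup Fs.
exists (sort le (undup s0)).
have srt : sorted le (sort le (undup s0)).
  apply: (@sort_sorted_in _ [in undup s0]); last exact/allP.
  move=> H K /= /memF FH /memF FK.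
  by apply/orP; case: (nested H K FH FK) => sub; [left|right]; apply/asboolP.
have le_trans : transitive le.
  by move=> K H L /asboolP HK /asboolP KL; apply/asboolP => x /HK/KL.
have le_refl : reflexive le by move=> H; apply/asboolP.
split=> [H|i j ij js]; first by rewrite mem_sort.
rewrite properEneq; split.
  rewrite nth_uniq ?sort_uniq ?undup_uniq ?(ltn_trans ij) //.
  by rewrite neq_ltn ij.
apply/asboolP; apply: (sorted_leq_nth le_trans le_refl setT srt);
  by rewrite ?inE ?(ltn_trans ij) // ltnW.
Qed.

Lemma canonical_leading_factor_chain (GN : Nfree G) :
  finite_set (canonical_chain G) ->
  (forall H, canonical_chain G H -> typeA H (canonical_pred H) ->
     finite_set (factor H (canonical_pred H))) ->
  exists (r : nat) (H : nat -> set G), leading_factor_chain r H.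
Proof.
move=> Vfin Afin.
have [s [sV s_lt]] := finite_nested_sequence Vfin canonical_nested.
(* Prepending [[set 1]] shifts indices: [H i.+1] is entry [i] of [s]. Indices up to [r] never reach
   the default [setT]. *)
pose r := size s; pose H i := nth setT ([set 1] :: s) i.
exists r, H.
have VH i : (i < r)%N -> canonical_chain G (H i.+1).
  by move=> ir; apply/sV/mem_nth.
have HS i : (i <= r)%N -> is_subgroup (H i).
  by case: i => [_|i ir]; [exact: set1_subgroup|exact/canonical_subgroup/VH].
have H_lt i : (i < r)%N -> H i `<` H i.+1.
  case: i => [|i] ir; last exact: (s_lt i i.+1).
  have [g Hg Pg] := canonical_pred_neq (VH 0%N ir).
  split=> [_ ->|sub]; first exact: canonical1 (VH _ ir).
  by apply: Pg; left; apply: sub.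
have H_le i j : (i <= j)%N -> (j < r)%N -> H i.+1 `<=` H j.+1.
  rewrite leq_eqVlt => /orP[/eqP->|ij] jr; first by [].
  by case: (s_lt i j ij jr).
(* This identifies the factors of the chain with the canonical quotients. *)
have predE i : (i < r)%N -> canonical_pred (H i.+1) = H i.
  move=> ir; apply/seteqP; split=> x.
    case=> [->|[L [/sV Ls [_ nL]] Lx]]; first exact: subgroup1 (HS _ (ltnW ir)).
    pose k := index L s; have kr : (k < r)%N by rewrite index_mem.
    have LE : L = H k.+1 by rewrite /H /= nth_index.
    have [ik|ki] := leqP i k; first by case: nL; rewrite LE; apply: H_le.
    by case: i ir nL ki => // i ir nL ki; apply: (H_le k); rewrite -?LE // ltnW.
  case: i ir => [_ ->|i ir Hx]; first by left.
  by right; exists (H i.+1) => //; split; [apply: VH; apply: ltnW|exact: H_lt].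
have kindA i : (i < r)%N -> typeA (H i.+1) (H i) <-> antichain_kind (H i.+1).
  by move=> ir; rewrite -(predE i ir); apply/typeA_antichain_kind/VH.
have kindC i : (i < r)%N -> typeC (H i.+1) (H i) <-> order_kind (H i.+1).
  by move=> ir; rewrite -(predE i ir); apply/typeC_order_kind/VH.
have Hr : H r = setT.
  apply/seteqP; split=> // x _.
  have [->|x1] := eqVneq x 1; first exact: subgroup1 (HS _ (leqnn r)).
  have /sV xs : canonical_chain G (strong_span 1 x) by exists x.
  pose k := index (strong_span 1 x) s; have kr : (k < r)%N by rewrite index_mem.
  have E : strong_span 1 x = H k.+1 by rewrite /H /= nth_index.
  have Hkx : H k.+1 x by rewrite -E; apply: strong_spanr.
  have r0 : (0 < r)%N := leq_ltn_trans (leq0n k) kr.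
  rewrite -(prednK r0); apply: (H_le k r.-1) Hkx; last by rewrite prednK.
  by rewrite -ltnS prednK.
have kind i : (i < r)%N -> order_kind (H i.+1) \/ antichain_kind (H i.+1).
  by move=> /VH; apply: canonical_kind.
split.
- by split=> // i /H_lt.
- move=> i ir; split; first exact: HS.
    case: i ir => [_ x y z -> -> xy yx|i /VH VHi].
      by apply/le_anti; rewrite xy yx.
    by apply: module_convex; have [] := canonical_strong VHi.
  case: i ir => [_ _ g ->|i /VH VHi]; first by rewrite conj1g.
  exact: canonical_normal.
- move=> i ir; case: (kind i ir) => [/(kindC i ir)|/(kindA i ir) HA]; first by left.
  by right; split=> //; have := Afin _ (VH i ir); rewrite predE //; apply.
- move=> i ir; have ir' := ltnW ir.
  (* If two consecutive members had the same kind, the element [x] supplied by the matching [_next]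
     lemma would drop first into [H i.+1] and then into its predecessor. *)
  rewrite (kindC i ir') (kindA i.+1 ir); split=> [HC|HA].
    have [x [Hx x1 Px]] := order_kind_next (VH i ir') (VH _ ir) (H_lt _ ir) HC.
    case: (kind _ ir) => // HC'.
    have Hx' : H i.+1 x by rewrite -(predE _ ir); apply: HC'.
    by case: Px; apply: HC.
  case: (kind _ ir') => // HA'.
  have [x [Hx x1 Px]] := antichain_kind_next (VH i ir') (VH _ ir) (H_lt _ ir) HA'.
  have Hx' : H i.+1 x by rewrite -(predE _ ir); apply: HA.
  by case: Px; apply: HA'.
- split=> [g i g1 ir Hg gmin|x y]; last by rewrite lt_div.
  case: i ir Hg gmin => [_ /eqP|i ir Hg gmin /=]; first by rewrite (negPf g1).
  have nHg : ~ H i g by apply: gmin.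
  have HiS := HS i (ltnW ir).
  have Hconv : is_module (H i) by rewrite -predE //; apply: canonical_pred_module.
  split=> [g_gt1|[HC [[a [_ [Ha [b Hb <-] le]]] ne]]].
    split.
      apply/kindC => //; case: (kind i ir) => // HA; case: nHg.
      by rewrite -predE //; apply: HA; rewrite // gt_comparable.
    split; last first.
      rewrite -{1}(lcoset1 (H i)) => /lcoset_eq; rewrite invg1 mul1g.
      by move/(_ HiS).
    exists 1, g; split; [exact: subgroup1|exact: lcoset_refl|exact: ltW].
  have : g < 1 \/ 1 < g.
    apply/strictly_comparableP; split=> //; apply: contraT => g_inc; case: nHg.
    by rewrite -predE //; apply: (kindC i ir).1.
  case=> // g_lt1; case: nHg.
  (* From [g < 1] follows [a <= g * b <= b] with both ends in [H i], so convexity applies. *)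
  have Hgb : H i (g * b).
    apply: (module_convex Hconv Ha Hb le).
    by have /(le_mulg2 1 b) := ltW g_lt1; rewrite !mul1g.
  by rewrite -(mulgK b g); apply: subgroupM => //; apply: subgroupV.
Qed.

(** * Widths of subsets, computed step by step along a leading-factor chain *)

Definition set_width (S : set G) (n : nat) : Prop :=
  (exists2 A, antichain A /\ A `<=` S & A #= `I_n) /\
  (forall A, antichain A -> A `<=` S -> A #<= `I_n).

Lemma card_le_IIP T (A : set T) n : A #<= `I_n <->
  exists f : T -> nat, (forall t, A t -> (f t < n)%N) /\
    {in A &, injective f}.
Proof.
split=> [/pcard_leP[f]|[f [fn finj]]].
  exists f; split=> [t At|]; first exact: (@funS _ _ _ _ f).
  exact: inj.
rewrite -(card_le_eql (inj_card_eq finj)).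
by apply: subset_card_le => _ [t At <-]; apply: fn.
Qed.

Lemma card_eq_II_enum T (t0 : T) (A : set T) n : A #= `I_n ->
  exists a : nat -> T, (forall k, (k < n)%N -> A (a k)) /\
    {in `I_n &, injective a}.
Proof.
move=> /card_set_bijP[f [_ finj fsurj]].
have /choice[a aP] : forall k, exists t, (k < n)%N -> A t /\ f t = k.
  move=> k; have [/fsurj[t At ft]|] := boolP (k < n)%N; first by exists t.
  by exists t0.
exists a; split=> [k /aP[]//|k l]; rewrite !inE => /aP[_ ak] /aP[_ al] E.
by rewrite -ak E.
Qed.

Lemma antichain_mul2l x (A : set G) : antichain A ->
  antichain [set y | A (x * y)].
Proof.
move=> Aanti y z Ay Az ne; rewrite -(comparable_mul2l x); apply: Aanti => //.
by apply: contraNneq ne => /mulgI->.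
Qed.

(** Distinct cosets of [K] in [H] are mutually incomparable, and each is a translate of [K]; an
    antichain of [H] therefore splits into independent antichains, one per coset. *)
Lemma set_width_typeA H K m n : is_subgroup H -> is_subgroup K -> K `<=` H ->
  typeA H K -> factor H K #= `I_n -> set_width K m -> set_width H (n * m).
Proof.
move=> HS KS KH HA /card_set_bijP[c [c_lt cinj csurj]] [[A0 [A0anti A0K] A0m] Km].
have in_factor x : H x -> factor H K (lcoset K x) by exists x.
have /choice[t tP] : forall k, exists x, (k < n)%N -> H x /\ c (lcoset K x) = k.
  move=> k; have [/csurj[C [x Hx <-] ck]|] := boolP (k < n)%N; first by exists x.
  by exists 1.
have ub A : antichain A -> A `<=` H -> A #<= `I_(n * m).
  move=> Aanti AH.
  have /choice[f fP] : forall k, exists f : G -> nat,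
      (forall y, A (t k * y) -> K y -> (f y < m)%N) /\
      {in [set y | A (t k * y) /\ K y] &, injective f}.
    move=> k; pose B := [set y | A (t k * y) /\ K y].
    have Banti : antichain B.
      by move=> y z [Ay _] [Az _]; apply: (antichain_mul2l (x := t k) Aanti).
    have /card_le_IIP[f [f_lt finj]] : B #<= `I_m by apply: Km => // y [].
    by exists f; split=> // y Ay Ky; apply: f_lt.
  pose q x := c (lcoset K x); pose u x := (t (q x))^-1 * x.
  have qn x : A x -> (q x < n)%N by move=> /AH/in_factor/c_lt.
  have uP x : A x -> A (t (q x) * u x) /\ K (u x).
    move=> Ax; rewrite mulVKg; split=> //; apply/lcoset_eq => //.
    have [Ht ct] := tP _ (qn x Ax).
    by apply: cinj; rewrite ?inE; [exact: in_factor|exact/in_factor/AH|].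
  (* Mixed-radix code: the coset number is the high digit, the index inside the translated coset the
     low digit. *)
  apply/card_le_IIP; exists (fun x => q x * m + f (q x) (u x))%N.
  have fm x : A x -> (f (q x) (u x) < m)%N.
    by move=> /uP[Ax Kx]; apply: (fP (q x)).1.
  split=> [x Ax|x y].
    rewrite (@leq_trans ((q x).+1 * m)) ?leq_mul2r ?(qn x) ?orbT //.
    by rewrite mulSn addnC ltn_add2r fm.
  rewrite !inE => Ax Ay E.
  have m_gt0 : (0 < m)%N := leq_ltn_trans (leq0n _) (fm x Ax).
  have qE : q x = q y.
    by have := congr1 (divn^~ m) E; rewrite !divnMDl // !divn_small ?addn0 ?fm.
  have : u x = u y.
    apply: (fP (q x)).2; rewrite ?inE; first exact: uP.
      by rewrite qE; apply: uP.
    by move: E; rewrite /= -qE => /addnI.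
  by rewrite /u qE => /mulgI.
split; last exact: ub.
have [a [aA ainj]] := card_eq_II_enum (1 : G) A0m.
(* The reverse decoding: a copy of the maximal antichain of [K] is placed in every coset. *)
pose b j := t (j %/ m)%N * a (j %% m)%N.
have bP j : (j < n * m)%N -> [/\ (j %/ m < n)%N, (j %% m < m)%N &
    A0 (a (j %% m)%N)].
  move=> jnm.
  have m_gt0 : (0 < m)%N by case: (m) jnm; rewrite ?muln0.
  by rewrite ltn_divLR // ltn_mod; split=> //; apply: aA; rewrite ltn_mod.
have Hb j : (j < n * m)%N -> H (b j).
  move=> /bP[jn jm Aj]; apply: subgroupM => //; first exact: (tP _ jn).1.
  by apply: KH; apply: A0K.
have bcmp j l : (j < n * m)%N -> (l < n * m)%N -> b j >=< b l -> j = l.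
  move=> jnm lnm cmp; have [jn jm Aj] := bP j jnm; have [ln lm Al] := bP l lnm.
  have cosetE k : (k < n * m)%N -> lcoset K (b k) = lcoset K (t (k %/ m)%N).
    move=> /bP[_ _ /A0K Kk]; apply/esym/lcoset_eq => //.
    by rewrite mulKg.
  have qE : (j %/ m = l %/ m)%N.
    rewrite -(tP _ jn).2 -(tP _ ln).2 -!cosetE //; congr c; apply/lcoset_eq => //.
    by apply: typeA_comparable HA _ _ cmp => //; apply: Hb.
  rewrite (divn_eq j m) (divn_eq l m) qE; congr addn.
  apply: ainj; rewrite ?inE //; apply/eqP; apply: contraTT cmp => ne.
  by rewrite /b qE comparable_mul2l; apply: A0anti.
have binj : {in `I_(n * m) &, injective b}.
  by move=> j l; rewrite !inE => jn ln E; apply: bcmp; rewrite // E comparablexx.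
exists (b @` `I_(n * m)); last exact: inj_card_eq.
split; last by move=> _ [j jn <-]; apply: Hb.
move=> _ _ [j jn <-] [l ln <-] ne; apply/negP => /(bcmp _ _ jn ln) E.
by rewrite E eqxx in ne.
Qed.

(** Pairwise incomparable elements share a coset of [K], so translating an antichain of [H] by the
    inverse of one of its points moves it into [K]. *)
Lemma set_width_typeC H K m : K `<=` H ->
  (forall x y, H x -> H y -> x >< y -> K (x^-1 * y)) -> is_subgroup K ->
  set_width K m -> set_width H m.
Proof.
move=> KH HC KS [[A0 [A0anti A0K] A0m] Km]; split.
  by exists A0 => //; split=> // x /A0K/KH.
move=> A Aanti AH; have [[x Ax]|/set0P/negP/negPn/eqP->] := pselect (A !=set0);
  last exact: card_ge0.
pose B := [set y | A (x * y)].
have BK : B `<=` K.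
  move=> y; rewrite /B /= => Axy; have [E|ne] := eqVneq x (x * y).
    by rewrite -(mulKg x y) -E mulVg; apply: subgroup1.
  rewrite -(mulKg x y); apply: HC; [exact: AH|exact: AH|exact: Aanti].
have Bm : B #<= `I_m by apply: Km => //; apply: antichain_mul2l.
apply: card_le_trans Bm.
have -> : A = *%g x @` B.
  apply/seteqP; split=> [y Ay|_ [y Ay <-] //].
  by exists (x^-1 * y); rewrite /B /= ?mulVKg.
exact: card_image_le.
Qed.

Lemma leading_factor_chain_width (r : nat) (H : nat -> set G) :
  leading_factor_chain r H -> has_width G (typeA_product r H).
Proof.
move=> [[H0 Hr Hlt] Hsub Hkind _ [lead _]].
have H_le i j : (i <= r)%N -> (j <= i)%N -> H j `<=` H i.
  elim: i => [|i IH] ir; first by rewrite leqn0 => /eqP->.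
  rewrite leq_eqVlt => /orP[/eqP->//|ji] x /(IH (ltnW ir) ji).
  by have [sub _] := Hlt _ ir; apply: sub.
have main i : (i <= r)%N -> set_width (H i) (typeA_product i H).
  elim: i => [_|i IH ir].
    rewrite /typeA_product big_ord0 H0; split; last first.
      have I1 : [set (1 : G)] #<= `I_1.
        by have := @card_set1 _ (1 : G); rewrite card_eq_le => /andP[].
      by move=> A _ A1; apply: card_le_trans I1; apply: subset_card_le.
    exists [set 1]; last exact: card_set1.
    by split=> // x y -> ->; rewrite eqxx.
  have {IH} := IH (ltnW ir); set m := typeA_product i H => Wm.
  have [HS _ _] := Hsub _ ir; have [KS _ _] := Hsub _ (ltnW ir).
  have [KH nHK] := Hlt _ ir.
  (* The filtered product is turned into an unfiltered one, where a factor not of type A contributes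
     [1], so that its last term can be split off. *)
  have prodE : typeA_product i.+1 H = (m *
      if `[< typeA (H i.+1) (H i) >]
      then #|` fset_set (factor (H i.+1) (H i))| else 1)%N.
    by rewrite /typeA_product big_mkcond big_ord_recr /= -big_mkcond.
  rewrite prodE.
  case: (Hkind i ir) => [HC|[HA Hfin]]; last first.
    rewrite asboolT // mulnC; apply: (set_width_typeA HS KS KH HA _ Wm).
    have [n Hn] := (finite_setP _).1 Hfin.
    by rewrite (card_fset_set Hn).
  have nA : ~ typeA (H i.+1) (H i).
    by move=> HA; apply: nHK; apply: typeA_typeC_trivial.
  rewrite asboolF // muln1; apply: set_width_typeC Wm => // x y Hx Hy ixy.
  apply: contrapT => nK.
  (* For [g] outside [H i], the index [i.+1] is the least one with [g] in the chain, so the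
     leading-factor order applies. It is used below for [x^-1 * y] or its inverse, whichever coset
     is above [H i]. *)
  have lt1 g : H i.+1 g -> ~ H i g -> factor_le (H i) (lcoset (H i) g) -> 1 < g.
    move=> Hg nHg le.
    have g1 : g != 1 by apply/eqP => g1; apply: nHg; rewrite g1; apply: subgroup1.
    have gmin j : (j < i.+1)%N -> ~ H j g.
      by rewrite ltnS => ji Hjg; apply: nHg; apply: H_le Hjg => //; apply: ltnW.
    apply: (lead g i.+1 g1 ir Hg gmin).2.
    split=> //; split=> // E; apply: nHg; rewrite E; exact: lcoset_refl.
  pose g := x^-1 * y.
  have Hg : H i.+1 g by apply: subgroupM => //; apply: subgroupV.
  have f1 : factor (H i.+1) (H i) (H i).
    by exists 1; [exact: subgroup1 | exact: lcoset1].
  have fg : factor (H i.+1) (H i) (lcoset (H i) g) by exists g.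
  move: ixy; rewrite -comparable_div -/g; apply/negP/negPn.
  case: (HC _ _ f1 fg) => [/(lt1 g Hg nK)|[_ [b [[k Kk <-] Kb gkb]]]].
    by move=> /ltW /ge_comparable.
  have : 1 < g^-1.
    apply: lt1; first exact: subgroupV.
      by move=> /(subgroupV KS); rewrite invgK.
    exists k, (g^-1 * b); split=> //; first by exists b.
    by rewrite -(le_mul2l g) mulVKg.
  by rewrite -(mulg1 g^-1) lt_div => /ltW /le_comparable.
have [[A [Aanti _] Am] ub] := main r (leqnn r); split; first by exists A.
by move=> B Banti; apply: ub => //; rewrite Hr.
Qed.

End OrderedGroups.

Theorem theorem8p1 (d : Order.disp_t) (G : orderedGroupType d) (GN : Nfree G) :
  [/\ ((~ exists A : set G, antichain A /\ infinite_set A) <->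
       (exists n : nat, has_width G n)),
      ((exists n : nat, has_width G n) <->
       (finite_set (canonical_chain G) /\
        forall H : set G, canonical_chain G H ->
          typeA H (canonical_pred H) ->
          finite_set (factor H (canonical_pred H)))),
      ((finite_set (canonical_chain G) /\
        forall H : set G, canonical_chain G H ->
          typeA H (canonical_pred H) ->
          finite_set (factor H (canonical_pred H))) <->
       (exists (r : nat) (H : nat -> set G), leading_factor_chain r H))
    & forall (r : nat) (H : nat -> set G), leading_factor_chain r H ->
        has_width G (typeA_product r H)].
Proof.
(* The conditions are joined in a single cycle: leading-factor chain, finite width, no infinite
   antichain, finite canonical chain with finite type A quotients, and back. *)
have chain_width : (exists r (H : nat -> set G), leading_factor_chain r H) ->
    exists n, has_width G n.
  by move=> [r [H /leading_factor_chain_width w]]; exists (typeA_product r H).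
have width_noinf : (exists n, has_width G n) ->
    ~ exists A : set G, antichain A /\ infinite_set A.
  move=> [n [_ ub]] [A [Aanti Ainf]]; apply: Ainf.
  by apply/finite_set_leP; exists n; apply: ub.
have noinf_canonical : ~ (exists A : set G, antichain A /\ infinite_set A) ->
    finite_set (canonical_chain G) /\ forall H : set G, canonical_chain G H ->
      typeA H (canonical_pred H) -> finite_set (factor H (canonical_pred H)).
  move=> noinf; split; first exact: canonical_chain_finite.
  move=> H VH HA; apply: typeA_factor_finite => //.
    exact: canonical_subgroup.
  exact: canonical_pred_subgroup.
have canonical_lead : finite_set (canonical_chain G) /\ (forall H : set G,
      canonical_chain G H -> typeA H (canonical_pred H) ->
      finite_set (factor H (canonical_pred H))) ->
    exists r (H : nat -> set G), leading_factor_chain r H.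
  by case; apply: canonical_leading_factor_chain.
split.
- by split=> [/noinf_canonical/canonical_lead/chain_width|/width_noinf].
- by split=> [/width_noinf/noinf_canonical|/canonical_lead/chain_width].
- by split=> [/canonical_lead|/chain_width/width_noinf/noinf_canonical].
- by move=> r H; apply: leading_factor_chain_width.
Qed.
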